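(* Let $n\ge 2$ and let $H(n,m)$ be a Heisenberg $n$-Lie algebra (of dimension $mn+1$) over a field with $m>1$. Then $$Z^\wedge(H(n,m))=H(n,m)^2=Z(H(n,m)).$$
   Context: An $n$-Lie algebra is a vector space $L$ over a field with a multilinear skew-symmetric operation $[x_1,\ldots,x_n]$ satisfying $[[x_1,\ldots,x_n],y_2,\ldots,y_n]=\sum_{i=1}^n[x_1,\ldots,[x_i,y_2,\ldots,y_n],\ldots,x_n]$. $L^2=[L,\dots,L]$ is the derived algebra (the subalgebra generated by all brackets), and the center is $Z(L)=\{z\in L: [z,L,\dots,L]=0\}$. $L$ is Heisenberg if $L^2=Z(L)$ and $\dim L^2=1$; $H(n,m)$ denotes a Heisenberg $n$-Lie algebra of dimension $mn+1$. The exterior center of $L$ is $Z^\wedge(L)=\{ l\in L:\ l\wedge l_2\wedge\dots\wedge l_n=0\ \text{ for all } l_2,\dots,l_n\in L\}$, where the elements $l\wedge l_2\wedge\dots\wedge l_n$ lie in the (non-abelian) exterior square $L\wedge L$ of $L$. As a vector space, $L\wedge L$ is generated by symbols $x_1\wedge\dots\wedge x_n$ ($x_i\in L$), multilinear and alternating in the $x_i$, subject to the relations $[x_1,\dots,x_n]\wedge y_2\wedge\dots\wedge y_n=\sum_{i=1}^n x_1\wedge\dots\wedge[x_i,y_2,\dots,y_n]\wedge\dots\wedge x_n$. Equivalently, if $L\cong F/R$ with $F$ a free $n$-Lie algebra, then $L\wedge L\cong F^2/[R,F,\dots,F]$ with $x_1\wedge\dots\wedge x_n$ corresponding to the class of $[f_1,\dots,f_n]$,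 $f_i$ a preimage of $x_i$. *)

(* Defs.v *)
From HB Require Import structures.
From mathcomp Require Import all_boot all_order all_fingroup all_algebra.
From mathcomp Require Import boolp classical_sets.
From mathcomp.multinomials Require Import freeg.

Set Implicit Arguments.
Unset Strict Implicit.
Unset Printing Implicit Defensive.

Import GRing.Theory.

Local Open Scope ring_scope.
Local Open Scope classical_set_scope.
Local Open Scope quotient_scope.

Section Subspaces.
Context (K : fieldType).

Definition is_subspace (V : lmodType K) (S : set V) : Prop :=
  submod_closed [in S].

Definition has_dim (V : vectType K) (S : set V) (d : nat) : Prop :=
  exists2 U : {vspace V}, S = [set` U] & \dim U = d.

Section QuotientSpace.
Context (V : lmodType K) (G : set V).

Definition linear_span : set V := smallest (@is_subspace V) G.

Definition in_linear_span (v : V) : bool := v \in linear_span.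

Lemma in_linear_span_submod : submod_closed in_linear_span.
Proof.
split=> [|a u v]; rewrite !inE.
  by move=> S [[S0 _] _]; move: S0; rewrite !inE.
move=> Su Sv S [[S0 Slin] SG].
have := Slin a u v; rewrite !inE; apply.
- by apply: Su; split.
- by apply: Sv; split.
Qed.

HB.instance Definition _ :=
  GRing.isSubmodClosed.Build K V in_linear_span in_linear_span_submod.

(* The quotient V / linear_span G. *)
Definition quot_space : Type :=
  Quotient.quot (GRing.ZmodClosed.clone V in_linear_span _).

HB.instance Definition _ := GRing.Zmodule.on quot_space.

Definition quot_scale (a : K) : quot_space -> quot_space :=
  lift_op1 quot_space ( *:%R a).

Lemma pi_quot_scale a :
  {morph \pi_quot_space : u / a *: u >-> quot_scale a u}.
Proof.
move=> u; rewrite /quot_scale; unlock; apply/eqP.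
rewrite -[_ == _]Quotient.idealrBE -scalerBr rpredZ //.
by rewrite Quotient.idealrBE reprK.
Qed.

Let quot_scaleA a b u : quot_scale a (quot_scale b u) = quot_scale (a * b) u.
Proof. by elim/quotW: u => u; rewrite -!pi_quot_scale scalerA. Qed.

Let quot_scale1 : left_id 1 quot_scale.
Proof. by elim/quotW=> u; rewrite -pi_quot_scale scale1r. Qed.

Let quot_scaleDr : right_distributive quot_scale +%R.
Proof.
move=> a; elim/quotW=> u; elim/quotW=> v.
by rewrite -[_ + _]Quotient.pi_add -!pi_quot_scale scalerDr [LHS]Quotient.pi_add.
Qed.

Let quot_scaleDl u : {morph quot_scale^~ u : a b / a + b}.
Proof.
elim/quotW: u => u a b /=.
by rewrite -!pi_quot_scale scalerDl [LHS]Quotient.pi_add.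
Qed.

HB.instance Definition _ := GRing.Zmodule_isLmodule.Build K quot_space
  quot_scaleA quot_scale1 quot_scaleDr quot_scaleDl.

End QuotientSpace.
End Subspaces.

Section NLie.
Context (K : fieldType) (n : nat).

Section Slots.
Context (L : lmodType K).
Implicit Types (x y : {ffun 'I_n -> L}) (v : L).

Definition set_slot x (i : 'I_n) v : {ffun 'I_n -> L} :=
  [ffun j => if j == i then v else x j].

(* The tuple (v, y_2, ..., y_n); the first entry of y is ignored. *)
Definition set_first v y : {ffun 'I_n -> L} :=
  [ffun j : 'I_n => if val j == 0%N then v else y j].

End Slots.

(* Skew-symmetry is the sign rule under permutation of the arguments; in
   characteristic 2 this is weaker than alternation, so alternating brackets
   are covered as well. *)
Record nLie_bracket (L : lmodType K) := NLieBracket {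
  bracket :> {ffun 'I_n -> L} -> L;
  bracket_linear : forall (x : {ffun 'I_n -> L}) i a u v,
    bracket (set_slot x i (a *: u + v)) =
      a *: bracket (set_slot x i u) + bracket (set_slot x i v);
  bracket_skew : forall (x : {ffun 'I_n -> L}) (s : 'S_n),
    bracket [ffun i => x (s i)] = (-1) ^+ s *: bracket x;
  bracket_jacobi : forall x y : {ffun 'I_n -> L},
    bracket (set_first (bracket x) y) =
      \sum_(i < n) bracket (set_slot x i (bracket (set_first (x i) y)))
}.

Section Algebra.
Context (L : lmodType K) (br : nLie_bracket L).

Definition is_subalgebra (S : set L) : Prop :=
  is_subspace S /\ forall x : {ffun 'I_n -> L}, (forall i, S (x i)) -> S (br x).

Definition derived : set L := smallest is_subalgebra (range br).

Definition center : set L := [set z | forall y, br (set_first z y) = 0].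

(* The formal linear combinations of tuples x, with basis the << x >>. *)
Local Notation free_tuples := {freeg {ffun 'I_n -> L} / K}.

Inductive wedge_relator : free_tuples -> Prop :=
| WedgeLinear x i a u v :
    wedge_relator (<< set_slot x i (a *: u + v) >>
                   - a *: << set_slot x i u >> - << set_slot x i v >>)
| WedgeAlternating (x : {ffun 'I_n -> L}) i j :
    i != j -> x i = x j -> wedge_relator << x >>
| WedgeBracket (x y : {ffun 'I_n -> L}) :
    wedge_relator (<< set_first (br x) y >>
      - \sum_(i < n) << set_slot x i (br (set_first (x i) y)) >>).

Definition exterior_square : lmodType K := quot_space wedge_relator.

Definition wedge (x : {ffun 'I_n -> L}) : exterior_square :=
  \pi_(quot_space wedge_relator) << x >>.

Definition exterior_center : set L :=
  [set l | forall y, wedge (set_first l y) = 0].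

End Algebra.

Definition is_heisenberg (L : vectType K) (br : nLie_bracket L) : Prop :=
  derived br = center br /\ has_dim (derived br) 1.

End NLie.

(* Main.v *)
Require Import Defs.
From HB Require Import structures.
From mathcomp Require Import all_boot all_fingroup all_algebra boolp.
From mathcomp Require Import classical_sets.
From mathcomp.multinomials Require Import freeg.

(** Let z span the derived algebra, which is also the center, and write the
bracket as br x = omega x *: z with a scalar n-linear form omega.

The line spanned by z lies in the exterior center.  Put T = wedge.  The bracket
relation of the exterior square becomes an exchange relation
  omega x *: T (z, y_2 .. y_n)
    = \sum_i omega (x_i, y_2 .. y_n) *: T (x with x_i replaced by z),
and, T and omega both being skew, it holds with z in any slot of the wedge
([exchange_slot]).  Fix x with omega x != 0: then all wedges containing z are
combinations of the n wedges tau_j = T (x with x_j replaced by z), and it is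
enough to kill these.  The n equations omega (x with x_i replaced by v) = 0
have a solution v outside the line of z, because dim L > n + 1
([form_kernel_vector]).  Expand T (x with x_j replaced by v and x_i by z),
i != j, along the exchange relation: each coefficient is omega of a tuple that
either has a repeated entry or is, up to sign, one of the tuples where v solves
the equations; so this wedge is 0.  For x with x_j replaced by v, on which omega
is 0, the exchange relation is thus reduced to
omega (v, y_2 .. y_n) *: tau_j = 0.  Since v is not central, some such scalar
is nonzero, so tau_j = 0 ([exchange_kernel_eq0]).

This argument uses omega = 0 on tuples with a repeated entry.  In
characteristic 2 a skew bracket may violate that; but then a tuple x with
x_i = x_j and omega x != 0 makes the right-hand side of the exchange relation
collapse, which kills the wedges containing z at once
([exchange_repeated_eq0]).

Conversely, an alternating n-linear form on L that vanishes on tuples meeting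
the line of z respects the relations of the exterior square, hence vanishes on
every tuple whose wedge is 0 ([wedge_eq0_form]).  If l is not a multiple of z,
the determinant of n suitable coordinates, all killing z, is such a form, and it
is 1 on some tuple starting with l ([separating_coordinates]); so l is not in
the exterior center. *)

Set Implicit Arguments.
Unset Strict Implicit.
Unset Printing Implicit Defensive.

Import GRing.Theory.

Local Open Scope ring_scope.
Local Open Scope classical_set_scope.
Local Open Scope quotient_scope.

(** * Replacing and permuting the entries of a tuple *)

Section SlotCalculus.
Context (K : fieldType) (n : nat) (L : lmodType K).
Implicit Types (x y : {ffun 'I_n -> L}) (i j : 'I_n) (u v : L).

Definition permute x (s : 'S_n) : {ffun 'I_n -> L} := [ffun k => x (s k)].

Lemma set_slot_same x i v : set_slot x i v i = v.
Proof. by rewrite ffunE eqxx. Qed.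

Lemma set_slot_other x i j v : j != i -> set_slot x i v j = x j.
Proof. by rewrite ffunE => /negbTE ->. Qed.

Lemma set_slot_id x i : set_slot x i (x i) = x.
Proof. by apply/ffunP=> k; rewrite ffunE; case: eqP => // ->. Qed.

Lemma set_slotK x i u v : set_slot (set_slot x i u) i v = set_slot x i v.
Proof. by apply/ffunP=> k; rewrite !ffunE; case: eqP. Qed.

Lemma set_slotC x i j u v : i != j ->
  set_slot (set_slot x i u) j v = set_slot (set_slot x j v) i u.
Proof.
move=> ij; apply/ffunP=> k; rewrite !ffunE.
by case: (eqVneq k j) => // ->; rewrite eq_sym (negbTE ij).
Qed.

Lemma set_slot_tperm x i j v : i != j ->
  permute (set_slot x i v) (tperm i j) = set_slot (set_slot x j v) i (x j).
Proof.
move=> ij; apply/ffunP=> k; rewrite !ffunE.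
have ji : (j == i) = false by rewrite eq_sym (negbTE ij).
by case: tpermP => [->|->|/eqP/negbTE-> /eqP/negbTE->]; rewrite ?eqxx ?ji.
Qed.

Lemma set_firstE (i0 : 'I_n) v y : val i0 = 0%N -> set_first v y = set_slot y i0 v.
Proof. by move=> i00; apply/ffunP=> k; rewrite !ffunE -val_eqE /= i00. Qed.

End SlotCalculus.

(** * Multilinear, alternating and skew maps *)

Section MultilinearMaps.
Context (K : fieldType) (n : nat) (L M : lmodType K).
Implicit Types (f : {ffun 'I_n -> L} -> M) (x : {ffun 'I_n -> L}).

Definition multilinear f := forall x i a u v,
  f (set_slot x i (a *: u + v)) = a *: f (set_slot x i u) + f (set_slot x i v).

Definition alternating f := forall x i j, i != j -> x i = x j -> f x = 0.

(** The sign rule for transpositions only: the bracket and the wedge enter the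
argument through exchanges of two slots. *)
Definition skew f := forall x i j, i != j -> f (permute x (tperm i j)) = - f x.

Lemma multilinearD f x i u v : multilinear f ->
  f (set_slot x i (u + v)) = f (set_slot x i u) + f (set_slot x i v).
Proof. by move=> fl; rewrite -[u]scale1r fl !scale1r. Qed.

Lemma multilinear0 f x i : multilinear f -> f (set_slot x i 0) = 0.
Proof.
move=> fl; apply: (addIr (f (set_slot x i 0))).
by rewrite -multilinearD // addr0 add0r.
Qed.

Lemma multilinearZ f x i a u : multilinear f ->
  f (set_slot x i (a *: u)) = a *: f (set_slot x i u).
Proof. by move=> fl; rewrite -[a *: u]addr0 fl multilinear0 // addr0. Qed.

Lemma alternating_skew f : multilinear f -> alternating f -> skew f.
Proof.
move=> fl fa x i j ij; set g := fun u v => f (set_slot (set_slot x i u) j v).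
have ji : j != i by rewrite eq_sym.
have gE u : g u u = 0.
  by apply: (fa _ i j) => //; rewrite set_slot_same set_slot_other // set_slot_same.
have gDl u1 u2 v : g (u1 + u2) v = g u1 v + g u2 v.
  by rewrite /g !(set_slotC _ _ _ ij) multilinearD.
have gDr u v1 v2 : g u (v1 + v2) = g u v1 + g u v2 by rewrite /g multilinearD.
have -> : f x = g (x i) (x j).
  by rewrite /g -(@set_slot_other _ _ _ x i j (x i)) // set_slot_id set_slot_id.
have -> : permute x (tperm i j) = set_slot (set_slot x i (x j)) j (x i).
  by rewrite -[in LHS](set_slot_id x i) set_slot_tperm // (set_slotC _ _ _ ji).
apply/eqP; rewrite -addr_eq0; apply/eqP.
by have := gE (x i + x j); rewrite gDl !gDr !gE add0r addr0 addrC.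
Qed.

End MultilinearMaps.

(** * Consequences of the exchange relation *)

Section ExchangeRelation.
Context (K : fieldType) (n : nat) (L M : lmodType K).
(* K^o carries K as a module over itself, so that the notions above apply to
   scalar forms. *)
Context (omega : {ffun 'I_n -> L} -> K^o) (T : {ffun 'I_n -> L} -> M).
Context (z : L) (i0 : 'I_n).
Implicit Types (x y w : {ffun 'I_n -> L}) (i j : 'I_n) (v : L).
Hypotheses (omega_skew : skew omega) (T_linear : multilinear T)
  (T_alt : alternating T).
Hypothesis exchange : forall x y,
  omega x *: T (set_slot y i0 z) =
  \sum_i omega (set_slot y i0 (x i)) *: T (set_slot x i z).

(** Transposing slots i0 and j in y changes the sign of every term on both
sides, so z may be placed in any slot j. *)
Lemma exchange_slot x y j :
  omega x *: T (set_slot y j z) =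
  \sum_i omega (set_slot y j (x i)) *: T (set_slot x i z).
Proof.
case: (eqVneq i0 j) => [<-|ij]; first exact: exchange.
have T_skew := alternating_skew T_linear T_alt.
have slotE v : set_slot y j v =
    permute (set_slot (permute y (tperm i0 j)) i0 v) (tperm i0 j).
  rewrite set_slot_tperm //; apply/ffunP=> k; rewrite !ffunE tpermR.
  case: (eqVneq k j) => [->|kj]; first by rewrite eq_sym (negbTE ij).
  by case: (eqVneq k i0) => [->|ki] //; rewrite tpermD // eq_sym.
rewrite slotE T_skew // scalerN exchange -sumrN.
by apply: eq_bigr => i _; rewrite slotE omega_skew // scaleNr.
Qed.

(** On the right of the exchange relation, a term where z replaces an entry other
than x_i and x_j still has a repeated entry.  The two remaining terms have the
same coefficient, and their wedges differ by a transposition, so they cancel. *)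
Lemma exchange_repeated_eq0 x i j y :
  i != j -> x i = x j -> omega x != 0 -> T (set_slot y i0 z) = 0.
Proof.
move=> ij xij nz; have ji : j != i by rewrite eq_sym.
apply/eqP; have := exchange x y.
rewrite (bigD1 i) //= (bigD1 j) //= big1 ?addr0 => [|k /andP[ki kj]].
  rewrite -xij -scalerDr.
  have -> : set_slot x j z = permute (set_slot x i z) (tperm i j).
    by rewrite set_slot_tperm // -xij -[in RHS](@set_slot_other _ _ _ x j i z) // set_slot_id.
  rewrite (alternating_skew T_linear T_alt) // subrr scaler0.
  by move/eqP; rewrite scaler_eq0 (negbTE nz).
have -> : T (set_slot x k z) = 0; last by rewrite scaler0.
by apply: (T_alt ij); rewrite !set_slot_other // eq_sym.
Qed.

(** The tuple x provides n wedges that span all wedges containing z, and v shows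
that each of these is 0; y witnesses that v does not lie in the kernel of
omega. *)
Lemma exchange_kernel_eq0 x v y w : alternating omega -> omega x != 0 ->
  (forall i, omega (set_slot x i v) = 0) -> omega (set_slot y i0 v) != 0 ->
  T (set_slot w i0 z) = 0.
Proof.
move=> omega_alt nzx vker nzy.
have two_slots i j : i != j -> T (set_slot (set_slot x j v) i z) = 0.
  move=> ij; have ji : j != i by rewrite eq_sym.
  apply/eqP; have := exchange_slot x (set_slot x j v) i.
  rewrite big1 => [/eqP|k _]; first by rewrite scaler_eq0 (negbTE nzx).
  have -> : omega (set_slot (set_slot x j v) i (x k)) = 0; last by rewrite scale0r.
  (* For k = j a transposition turns the tuple into x with v in slot i; for
     k = i the tuple is x with v in slot j; otherwise x_k occurs twice. *)
  case: (eqVneq k j) => [->|kj].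
    by rewrite -set_slot_tperm // omega_skew // vker oppr0.
  case: (eqVneq k i) => [->|ki].
    by rewrite -[X in set_slot _ i X](@set_slot_other _ _ _ x j i v) // set_slot_id.
  by apply: (omega_alt _ k i) => //; rewrite set_slot_same !set_slot_other.
have one_slot j : T (set_slot x j z) = 0.
  apply/eqP; have := exchange (set_slot x j v) y.
  rewrite vker scale0r (bigD1 j) //= big1 ?addr0 => [/esym/eqP|i ij].
    by rewrite set_slot_same set_slotK scaler_eq0 (negbTE nzy).
  by rewrite two_slots // scaler0.
apply/eqP; have := exchange x w; rewrite big1 => [/eqP|i _].
  by rewrite scaler_eq0 (negbTE nzx).
by rewrite one_slot scaler0.
Qed.

End ExchangeRelation.

(** * Maps into and out of the exterior square *)

Section QuotientMap.
Context (K : fieldType) (V : lmodType K) (G : set V).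

(** A name of its own for the canonical surjection, to carry its linear map
structure. *)
Definition quot_proj : V -> quot_space G := \pi_(quot_space G).

Fact quot_proj_linear : linear quot_proj.
Proof. by move=> a u v; rewrite [LHS]Quotient.pi_add pi_quot_scale. Qed.

HB.instance Definition _ :=
  GRing.isLinear.Build K V (quot_space G) _ quot_proj quot_proj_linear.

Lemma quot_proj_eq0 v : quot_proj v = 0 <-> linear_span G v.
Proof.
rewrite -(raddf0 quot_proj) /quot_proj; split=> [/eqP|Gv]; last apply/eqP;
  rewrite -[_ == _]Quotient.idealrBE subr0; [exact: set_mem | exact: mem_set].
Qed.

Lemma quot_proj_relator v : G v -> quot_proj v = 0.
Proof. by move=> Gv; apply/quot_proj_eq0; apply: sub_gen_smallest. Qed.

(** The kernel of a linear map is one of the subspaces over which the span is an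
intersection. *)
Lemma linear_vanish_span (M : lmodType K) (f : {linear V -> M}) v :
  (forall u, G u -> f u = 0) -> linear_span G v -> f v = 0.
Proof.
move=> fG; apply: (smallest_sub (X := [set u | f u = 0])) => //.
split=> [|a u w]; rewrite !inE /= ?raddf0 //.
by move=> fu fw; rewrite linearP fu fw scaler0 addr0.
Qed.

End QuotientMap.

Lemma freeg_linear_extension (K : fieldType) (S : choiceType) (M : lmodType K)
    (f : S -> M) :
  exists g : {linear {freeg S / K} -> M}, forall x, g << x >> = f x.
Proof.
have fadd : additive (fglift f : {freeg S / K} -> M) := lift_is_additive f.
pose fA : {additive {freeg S / K} -> M} :=
  HB.pack (fglift f : {freeg S / K} -> M)
    (GRing.isZmodMorphism.Build _ _ (fglift f : {freeg S / K} -> M) fadd).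
have fscal : scalable (fglift f : {freeg S / K} -> M).
  move=> a D; have fE E : fglift f E = \sum_(x <- dom E) coeff x E *: f x.
    rewrite -{1}[E]freeg_sumE -[LHS]/(fA _) raddf_sum.
    by apply: eq_bigr => x _; rewrite /fA /= liftU.
  rewrite [in RHS]fE scaler_sumr [a *: D]/(fgscale a D).
  rewrite -[LHS]/(fA _) raddf_sum.
  by apply: eq_bigr => x _; rewrite /fA /= liftU scalerA.
pose g : {linear {freeg S / K} -> M} :=
  HB.pack (fA : _ -> _) fA (GRing.isScalable.Build _ _ _ _ (fglift f) fscal).
by exists g => x; rewrite /g /= liftU scale1r.
Qed.

Section WedgeProduct.
Context (K : fieldType) (n : nat) (L : lmodType K) (br : nLie_bracket n L).
Implicit Types (x y u v : {ffun 'I_n -> L}).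

Lemma wedge_multilinear : multilinear (wedge br).
Proof.
move=> x i a u v; apply/eqP; rewrite -subr_eq0 opprD addrA; apply/eqP.
by have := quot_proj_relator (WedgeLinear br x i a u v); rewrite !linearB linearZ.
Qed.

Lemma wedge_alternating : alternating (wedge br).
Proof. by move=> x i j ij xij; apply: quot_proj_relator (WedgeAlternating br ij xij). Qed.

Lemma wedge_bracket x y : wedge br (set_first (br x) y) =
  \sum_(i < n) wedge br (set_slot x i (br (set_first (x i) y))).
Proof.
apply/eqP; rewrite -subr_eq0; apply/eqP.
by have := quot_proj_relator (WedgeBracket br x y); rewrite linearB linear_sum.
Qed.

(** The universal property of the exterior square, in the form in which it shows
that a wedge is nonzero: the linear extension of phi to formal combinations
of tuples kills the relators. *)
Lemma wedge_eq0_form (M : lmodType K) (phi : {ffun 'I_n -> L} -> M) x :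
    multilinear phi -> alternating phi ->
    (forall u v, phi (set_first (br u) v) =
       \sum_(i < n) phi (set_slot u i (br (set_first (u i) v)))) ->
  wedge br x = 0 -> phi x = 0.
Proof.
move=> phi_linear phi_alt phi_br /quot_proj_eq0.
have [g gE] := freeg_linear_extension phi.
rewrite -gE; apply: linear_vanish_span => _ [u i a v w|u i j|u v].
- by rewrite !linearB linearZ /= !gE phi_linear addrAC addrK subrr.
- by rewrite gE; apply: phi_alt.
- by rewrite linearB linear_sum /= gE phi_br; apply/eqP; rewrite subr_eq0;
  apply/eqP/eq_bigr => i _; rewrite gE.
Qed.

End WedgeProduct.

(** * Brackets with values in a line *)

Section OneDimensionalDerived.
Context (K : fieldType) (n : nat) (L : vectType K) (br : nLie_bracket n L).
Context (i0 : 'I_n) (z : L) (omega : {ffun 'I_n -> L} -> K^o).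
Implicit Types (x y w : {ffun 'I_n -> L}).
Hypotheses (i0_first : val i0 = 0%N) (z_neq0 : z != 0)
  (brE : forall x, br x = omega x *: z).

Let scale_inj : injective (fun a : K^o => a *: z).
Proof.
move=> a b /= /eqP; rewrite -subr_eq0 -scalerBl scaler_eq0 (negbTE z_neq0) orbF.
by rewrite subr_eq0 => /eqP.
Qed.

Lemma form_multilinear : multilinear omega.
Proof.
move=> x i a u v; apply: scale_inj.
by rewrite /= scalerDl -[in RHS]scalerA -!brE bracket_linear.
Qed.

Lemma form_skew : skew omega.
Proof.
move=> x i j ij; apply: scale_inj => /=; rewrite scaleNr -!brE.
by rewrite [LHS](bracket_skew br) odd_tperm ij expr1 scaleN1r.
Qed.

(** The bracket relation of the exterior square, with the brackets written as
multiples of z and the scalars pulled out of the wedges. *)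
Lemma form_exchange x y :
  omega x *: wedge br (set_slot y i0 z) =
  \sum_i omega (set_slot y i0 (x i)) *: wedge br (set_slot x i z).
Proof.
have wl := @wedge_multilinear _ _ _ br.
have := wedge_bracket br x y; rewrite (set_firstE _ _ i0_first) brE.
rewrite multilinearZ // => ->; apply: eq_bigr => i _.
by rewrite (set_firstE _ _ i0_first) brE multilinearZ.
Qed.

(** The n linear conditions on v cut out a subspace of dimension at least
dim L - n > 1, which is too large to lie in a line. *)
Lemma form_kernel_vector x : (n.+1 < \dim (fullv : {vspace L}))%N ->
  exists2 v, v \notin <[z]>%VS & forall i, omega (set_slot x i v) = 0.
Proof.
move=> dimL; pose f v : 'rV[K]_n := \row_i (omega (set_slot x i v) : K).
have f_linear : linear f.
  by move=> a u v; apply/rowP=> i; rewrite !mxE form_multilinear.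
pose fl : {linear L -> 'rV[K]_n} :=
  HB.pack f (GRing.isLinear.Build _ _ _ _ f f_linear).
have /subvPn[v kv nzv] : ~~ (lker (linfun fl) <= <[z]>)%VS.
  apply/negP=> /dimvS; rewrite dim_vline z_neq0 leqNgt => /negP; apply.
  have := limg_ker_dim (linfun fl) fullv; rewrite capfv => dimE.
  have := dimvS (subvf (limg (linfun fl))); rewrite dimvf /dim /= mul1n.
  move=> imn; rewrite -(ltn_add2r (\dim (limg (linfun fl)))) dimE.
  by apply: leq_ltn_trans dimL; rewrite add1n ltnS.
exists v => // i; move: kv; rewrite memv_ker lfunE /= => /eqP/rowP/(_ i).
by rewrite !mxE.
Qed.

(** Joins the two cases, omega alternating or not.  The center being inside the
line of z means that omega is nondegenerate modulo that line. *)
Lemma derived_wedge_eq0 w : (n.+1 < \dim (fullv : {vspace L}))%N ->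
  center br `<=` [set` <[z]>%VS] -> wedge br (set_slot w i0 z) = 0.
Proof.
move=> dimL centerz.
have wl := @wedge_multilinear _ _ _ br; have wa := @wedge_alternating _ _ _ br.
have nondegenerate v : v \notin <[z]>%VS -> exists y, omega (set_slot y i0 v) != 0.
  move=> vz; apply: contrapT => noy; move/negP: vz; apply; apply: centerz => y.
  rewrite (set_firstE _ _ i0_first) brE.
  by case: (eqVneq (omega (set_slot y i0 v)) 0) => [->|nz];
    [rewrite scale0r | case: noy; exists y].
have [omega_alt|] := pselect (alternating omega); last first.
  move=> /existsNP[x /existsNP[i /existsNP[j /not_implyP[ij /not_implyP[xij /eqP nz]]]]].
  exact: exchange_repeated_eq0 form_exchange _ _ _ _ ij xij nz.
(* Any tuple yields a noncentral vector v0, hence a tuple on which omega is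
   nonzero; the kernel vector that matters is then computed for that tuple. *)
have [v0 /nondegenerate[y0 nz0] _] := form_kernel_vector [ffun=> 0] dimL.
have [v /nondegenerate[y nz] ker] := form_kernel_vector (set_slot y0 i0 v0) dimL.
exact: (exchange_kernel_eq0 form_skew wl wa form_exchange w omega_alt nz0 ker nz).
Qed.

End OneDimensionalDerived.

(** * Determinant forms *)

Section DeterminantForm.
Context (K : fieldType) (n : nat) (L : vectType K).
Context (p : {linear L -> 'rV[K]_n}).
Implicit Types x : {ffun 'I_n -> L}.

Definition det_form (x : {ffun 'I_n -> L}) : K^o := \det (\matrix_i p (x i)).

Lemma det_form_multilinear : multilinear det_form.
Proof.
move=> x i a u v; rewrite /det_form -[RHS]/(a * \det _ + \det _) -[X in _ = _ + X]mul1r.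
apply: (@determinant_multilinear _ _ _ _ _ i).
- by rewrite scale1r !rowK !set_slot_same linearP.
- by apply/matrixP=> j k; rewrite !mxE !set_slot_other // eq_sym neq_lift.
- by apply/matrixP=> j k; rewrite !mxE !set_slot_other // eq_sym neq_lift.
Qed.

Lemma det_form_alternating : alternating det_form.
Proof.
by move=> x i j ij xij; apply: (determinant_alternate ij) => k; rewrite !mxE xij.
Qed.

Lemma det_form_kernel x i v : p v = 0 -> det_form (set_slot x i v) = 0.
Proof.
move=> pv; rewrite /det_form (expand_det_row _ i) big1 // => j _.
by rewrite !mxE set_slot_same pv mxE mul0r.
Qed.

End DeterminantForm.

(** Extend z, l to a basis of L.  The coordinates of index 1 to n kill z, which
has index 0, and their matrix on the n basis vectors starting with l is the
identity. *)
Lemma separating_coordinates (K : fieldType) (n : nat) (L : vectType K)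
    (i0 : 'I_n) (z l : L) : val i0 = 0%N -> (n < \dim (fullv : {vspace L}))%N ->
    z != 0 -> l \notin <[z]>%VS ->
  exists p : {linear L -> 'rV[K]_n}, p z = 0 /\
    exists y, det_form p (set_slot y i0 l) = 1.
Proof.
move=> i0_first dimL z_neq0 lz.
have freeZL : free [:: l; z] by rewrite free_cons span_seq1 lz seq1_free.
pose S := span [:: z; l].
have freeS : free [:: z; l].
  by rewrite (perm_free (Y := [:: l; z])) // (perm_catC [:: z] [:: l]).
pose X := [:: z; l] ++ vbasis S^C%VS.
have freeX : free X.
  rewrite cat_free freeS (basis_free (vbasisP _)) /=.
  by rewrite (span_basis (vbasisP _)); apply/directv_addP/capv_compl.
have sizeX : size X = \dim (fullv : {vspace L}).
  rewrite size_cat (size_tuple (vbasis _)) dimv_compl -(eqP freeS) subnKC //.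
  exact: dimvS (subvf _).
have ltX (i : 'I_n) : (i.+1 < size X)%N.
  by rewrite sizeX; apply: leq_ltn_trans dimL.
pose ix i := Ordinal (ltX i).
pose f v : 'rV[K]_n := \row_j coord (in_tuple X) (ix j) v.
have f_linear : linear f by move=> a u v; apply/rowP=> j; rewrite !mxE linearP.
pose p : {linear L -> 'rV[K]_n} :=
  HB.pack f (GRing.isLinear.Build _ _ _ _ f f_linear).
have pE (k : 'I_(size X)) j : p X`_k 0 j = (k == ix j)%:R.
  by rewrite mxE (coord_free (X := in_tuple X)).
have X_gt0 : (0 < size X)%N by [].
exists p; split; first by apply/rowP=> j; rewrite (pE (Ordinal X_gt0)) mxE.
exists [ffun i : 'I_n => X`_i.+1].
have -> : l = [ffun i : 'I_n => X`_i.+1] i0 by rewrite ffunE i0_first.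
rewrite set_slot_id /det_form (_ : \matrix_i _ = 1%:M) ?det1 //.
by apply/matrixP=> i j; rewrite mxE [RHS]mxE ffunE; apply: (pE (ix i) j).
Qed.

(** * The exterior center of a Heisenberg algebra *)

Theorem lemma1p20 (K : fieldType) (n m : nat) (L : vectType K)
    (br : nLie_bracket n L) (hn : (2 <= n)%N) (hm : (1 < m)%N)
    (hdim : \dim (fullv : {vspace L}) = (m * n + 1)%N)
    (hbr : is_heisenberg br) :
  exterior_center br = derived br /\ derived br = center br.
Proof.
have [derived_center [U derivedU dimU]] := hbr; split=> //.
have n_gt0 : (0 < n)%N by apply: ltn_trans hn.
pose i0 : 'I_n := Ordinal n_gt0; have i0_first : val i0 = 0%N by [].
(* m * n + 1 >= 2 * n + 1 > n + 1 as m > 1 and n > 1. *)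
have dimL : (n.+1 < \dim (fullv : {vspace L}))%N.
  rewrite hdim addn1 ltnS; apply: leq_trans (leq_mul hm (leqnn n)).
  by rewrite mul2n -addnn -[X in (X <= _)%N]addn1 leq_add2l.
set z := vpick U.
have z_neq0 : z != 0 by rewrite vpick0 -dimv_eq0 dimU.
have Uz : U = <[z]>%VS.
  by apply/eqP; rewrite eq_sym eqEdim -memvE memv_pick dimU dim_vline z_neq0.
have derivedz : derived br = [set` <[z]>%VS] by rewrite derivedU Uz.
have brz x : br x \in <[z]>%VS.
  have : derived br (br x) by apply: sub_gen_smallest; exists x.
  by rewrite derivedz.
pose omega x : K^o := coord [tuple z] ord0 (br x).
have brE x : br x = omega x *: z.
  by rewrite {1}(@coord_span _ _ _ [tuple z] (br x)) ?span_seq1 // big_ord1.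
apply/seteqP; split=> l /=.
  rewrite derivedz /= => lext; apply: contrapT => /negP lz.
  have [p [pz [y]]] := separating_coordinates i0_first (ltnW dimL) z_neq0 lz.
  have pker x i v : v \in <[z]>%VS -> det_form p (set_slot x i v) = 0.
    by case/vlineP=> a ->; apply: det_form_kernel; rewrite linearZ /= pz scaler0.
  have /wedge_eq0_form -> := lext y; rewrite ?(set_firstE _ _ i0_first) //.
  - by move/esym/eqP; rewrite oner_eq0.
  - exact: det_form_multilinear.
  - exact: det_form_alternating.
  - move=> u v; rewrite (set_firstE _ _ i0_first) pker // big1 // => i _.
    exact: pker.
rewrite derivedz /= => /vlineP[a ->] y.
rewrite (set_firstE _ _ i0_first) multilinearZ; last exact: wedge_multilinear.
rewrite (derived_wedge_eq0 i0_first z_neq0 brE) ?scaler0 //.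
by rewrite -derived_center derivedz.
Qed.
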